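(* Let $m\ge 3$ and let $n$ be even with $n\ge 4$. Then $W(C_{m,n})>W(D_{m,n})$.
   Context: For a digraph $D$, $d_D(u,v)$ is the length of a shortest directed path from $u$ to $v$, and $d_D(u,v)=0$ if there is no such path. The Wiener index is $W(D)=\sum_{(u,v)\in V(D)\times V(D)} d_D(u,v)$, the sum over all ordered pairs. The grid $G_{m,n}=P_m\Box P_n$ has vertices $(i,j)$, $1\le i\le m$ (row, row $1$ being the top row), $1\le j\le n$ (column), with $(i,j)$ adjacent to $(i\pm1,j)$ and $(i,j\pm1)$. $D_{m,n}$ is the orientation of $G_{m,n}$ in which: for each column $j\le n-1$ the vertical edges are oriented upward, $(i+1,j)\to(i,j)$; in column $n$ downward, $(i,n)\to(i+1,n)$; row $1$ is oriented to the right, $(1,j)\to(1,j+1)$; and every row $i\ge 2$ is oriented to the left, $(i,j+1)\to(i,j)$. For $m\ge 3$ and even $n\ge 4$, the comb orientation $C_{m,n}$ is defined as follows. First orient the edges of the Hamiltonian cycle $(1,1),(1,2),\dots,(1,n),(2,n),\dots,(m,n),(m,n-1),(m-1,n-1),\dots,(2,n-1),(2,n-2),(3,n-2),\dots,(m,n-2),(m,n-3),\dots,(2,2),(3,2),\dots,(m,2),(m,1),(m-1,1),\dots,(2,1),(1,1)$ along the cycle (row $1$ rightward; column $n$ downward; arcs $(m,j)\to(m,j-1)$ for even $j$; odd columns $3\le j\le n-1$ upward from row $m$ to row $2$ followed by $(2,j)\to(2,j-1)$; even columns $2\le j\le n-2$ downward from row $2$ to row $m$; column $1$ upward from $(m,1)$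 to $(1,1)$). All remaining edges: every remaining horizontal edge $\{(i,j),(i,j+1)\}$ with $2\le i\le m$ is oriented $(i,j)\to(i,j+1)$, and every remaining vertical edge $\{(1,j),(2,j)\}$, $2\le j\le n-1$, is oriented $(2,j)\to(1,j)$. *)

(* Defs.v *)
From mathcomp Require Import all_boot zify.

Set Implicit Arguments.
Unset Strict Implicit.
Unset Printing Implicit Defensive.

Section Wiener.
Variables (T : finType) (e : rel T).

Definition has_dipath (u v : T) (k : nat) : bool :=
  [exists p : k.-tuple T, [&& path e u p, last u p == v & uniq (u :: p)]].

(* The lengths of directed paths from u to v, in increasing order, are the k
   kept by the filter (a directed path has at most #|T| vertices); the default
   value of head covers the case where there is no such path. *)
Definition dist (u v : T) : nat :=
  head 0 [seq k <- iota 0 #|T| | has_dipath u v k].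

Definition wiener : nat := \sum_(p : T * T) dist p.1 p.2.

Lemma has_dipathP u v k :
  reflect (exists p, [/\ path e u p, last u p = v, uniq (u :: p) & size p = k])
          (has_dipath u v k).
Proof.
apply: (iffP existsP) => [[p /and3P[pp /eqP lp up]]|[p [pp lp up sp]]].
  by exists p; split=> //; rewrite size_tuple.
by exists (Tuple (introT eqP sp)); rewrite /= pp lp eqxx.
Qed.

Lemma has_dipath_lt u v k : has_dipath u v k -> k < #|T|.
Proof.
case/has_dipathP=> p [_ _ up <-].
by have := max_card [in u :: p]; rewrite (card_uniqP up).
Qed.

Lemma dist_le u p : path e u p -> dist u (last u p) <= size p.
Proof.
case/shortenP=> p' pp' up' sp'.
apply: leq_trans (_ : size p' <= _); last first.
  by apply: uniq_leq_size => //; case/andP: up'.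
have h : has_dipath u (last u p') (size p') by apply/has_dipathP; exists p'.
rewrite /dist; set s := filter _ _.
have ms : size p' \in s by rewrite mem_filter h mem_iota (has_dipath_lt h).
have ss : sorted ltn s by apply: sorted_filter (iota_ltn_sorted _ _); apply: ltn_trans.
case: s ms ss => [//|a s] /=; rewrite inE => /predU1P[->//|ms] ss.
by have /allP/(_ _ ms)/ltnW := order_path_min ltn_trans ss.
Qed.

Lemma dist_path u v : connect e u v ->
  exists p, [/\ path e u p, last u p = v, uniq (u :: p) & size p = dist u v].
Proof.
case/connectP=> q pq ->; case/shortenP: pq => p pp up _.
have h : has_dipath u (last u p) (size p) by apply/has_dipathP; exists p.
suff /has_dipathP : has_dipath u (last u p) (dist u (last u p)) by [].
rewrite /dist; set s := filter _ _.
have ms : size p \in s by rewrite mem_filter h mem_iota (has_dipath_lt h).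
have : head 0 s \in s by case: s ms => [//|a s] _; rewrite mem_head.
by rewrite mem_filter => /andP[].
Qed.

Lemma dist_unreachable u v : ~~ connect e u v -> dist u v = 0.
Proof.
move=> nc; rewrite /dist (eq_filter (a2 := pred0)) ?filter_pred0 // => k /=.
apply/negbTE/negP => /has_dipathP[p [pp lp _ _]]; case/negP: nc.
by apply/connectP; exists p.
Qed.

End Wiener.

Section Grid.
Variables m n : nat.

Definition vertex : finType := ('I_m * 'I_n)%type.

(* Coordinates are numbered from 1. *)
Definition irow (u : vertex) : nat := u.1.+1.
Definition icol (u : vertex) : nat := u.2.+1.

Implicit Types u v : vertex.

Definition right_arc u v := (irow u == irow v) && (icol v == (icol u).+1).
Definition left_arc u v := right_arc v u.
Definition down_arc u v := (icol u == icol v) && (irow v == (irow u).+1).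
Definition up_arc u v := down_arc v u.

Definition grid u v :=
  [|| right_arc u v, left_arc u v, down_arc u v | up_arc u v].

Definition D_arc u v :=
  [|| (icol u <= n - 1) && up_arc u v,
      (icol u == n) && down_arc u v,
      (irow u == 1) && right_arc u v
    | (2 <= irow u) && left_arc u v].

(* Arcs of the Hamiltonian cycle: row 1 rightward, column n downward, the
   connections in row m out of even columns, the inner odd columns upward to row
   2 and then one step left along row 2, the inner even columns downward from
   row 2, and column 1 upward. *)
Definition comb_cycle_arc u v :=
  [|| (irow u == 1) && right_arc u v,
      (icol u == n) && down_arc u v,
      [&& irow u == m, ~~ odd (icol u) & left_arc u v],
      [&& odd (icol u), 3 <= icol u <= n - 1, 2 <= irow v & up_arc u v],
      [&& odd (icol u), 3 <= icol u <= n - 1, irow u == 2 & left_arc u v],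
      [&& ~~ odd (icol u), 2 <= icol u <= n - 2, 2 <= irow u & down_arc u v]
    | (icol u == 1) && up_arc u v].

(* The last conjunct orients the grid edges not used by the cycle. *)
Definition C_arc u v :=
  comb_cycle_arc u v ||
  [&& ~~ comb_cycle_arc u v, ~~ comb_cycle_arc v u
    & (2 <= irow u) && right_arc u v ||
      [&& irow u == 2, 2 <= icol u <= n - 1 & up_arc u v]].

Definition orientation (e : rel vertex) :=
  (forall u v, grid u v = e u v || e v u) /\ (forall u v, ~~ (e u v && e v u)).

Lemma right_arcE u v : right_arc u v ->
  [/\ right_arc v u = false, down_arc u v = false, down_arc v u = false,
      irow v = irow u & icol v = (icol u).+1].
Proof. rewrite /right_arc /down_arc => /andP[/eqP<- /eqP->]; split=> //; lia. Qed.

Lemma down_arcE u v : down_arc u v ->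
  [/\ down_arc v u = false, right_arc u v = false, right_arc v u = false,
      icol v = icol u & irow v = (irow u).+1].
Proof. rewrite /right_arc /down_arc => /andP[/eqP<- /eqP->]; split=> //; lia. Qed.

Lemma orientationP (e : rel vertex) :
  (forall u v, e u v -> grid u v) ->
  (forall u v, right_arc u v || down_arc u v -> e u v (+) e v u) ->
  orientation e.
Proof.
have gridC u v : grid u v = grid v u.
  by rewrite /grid /left_arc /up_arc; case: (right_arc u v); case: (right_arc v u);
    case: (down_arc u v); case: (down_arc v u).
have gridE u v : grid u v ->
    (right_arc u v || down_arc u v) || (right_arc v u || down_arc v u).
  by rewrite /grid /left_arc /up_arc; case: (right_arc u v); case: (right_arc v u);
    case: (down_arc u v); case: (down_arc v u).
move=> eg ex; have exg u v : grid u v -> e u v (+) e v u.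
  by case/gridE/orP=> /ex //; rewrite addbC.
split=> u v; last by apply/negP=> /andP[a b]; have := exg u v (eg _ _ a); rewrite a b.
apply/idP/orP=> [/exg|[/eg//|/eg]]; last by rewrite gridC.
by case: (e u v); [left | right].
Qed.

Lemma D_orientation : orientation D_arc.
Proof.
apply: orientationP => u v.
  by rewrite /D_arc /grid; case/or4P=> /andP[_ ->]; rewrite ?orbT.
have : [/\ 0 < irow u, 0 < icol v & icol v <= n] by split=> //; apply: ltn_ord.
rewrite /D_arc /up_arc /left_arc => -[ui vi vn] /orP[] h.
  by have [-> -> -> ri ci] := right_arcE h; rewrite h ri; lia.
by have [-> -> -> ci ri] := down_arcE h; rewrite h ci; lia.
Qed.

Lemma C_orientation : 3 <= m -> 4 <= n -> ~~ odd n -> orientation C_arc.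
Proof.
move=> hm hn en; apply: orientationP => u v.
  rewrite /C_arc /comb_cycle_arc /grid.
  case: (right_arc u v); case: (left_arc u v); case: (down_arc u v);
    case: (up_arc u v) => //=.
  by rewrite !andbF.
have : [/\ 0 < irow u, irow v <= m, 0 < icol u & icol v <= n].
  by split=> //; apply: ltn_ord.
rewrite /C_arc /comb_cycle_arc /up_arc /left_arc => -[u1 vm u2 vn] /orP[] h.
  have [-> -> -> ri ci] := right_arcE h; rewrite h ri ci {h ri ci} in vm vn *.
  rewrite !(andbF, andbT, orbF); lia.
have [-> -> -> ci ri] := down_arcE h; rewrite h ri ci {h ri ci} in vm vn *.
rewrite !(andbF, andbT, orbF); lia.
Qed.

End Grid.

(* Main.v *)
Require Import Defs.
From mathcomp Require Import all_boot zify.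

Set Implicit Arguments.
Unset Strict Implicit.
Unset Printing Implicit Defensive.

(* With 0-based coordinates, M = m - 1 and N = n - 1, explicit functions bound
   the distances in both orientations. [D_bound] dominates the distance in D:
   every vertex other than the target has an out-neighbour at which it is
   smaller. [C_bound] is dominated by the distance in C: it vanishes at the
   target and decreases by at most 1 along an arc, and C is strongly connected.
   The point of [C_bound] is that the only arcs leading from column c + 1 to
   column c lie in the last row or in the second one, alternately, so that
   moving left by one column costs about M steps.
   The two bounds are then summed over the rows for fixed columns j and l, and
   the contributions of (j, l) and (l, j) are added, which makes the absolute
   values disappear. The totals are polynomials in M and n (up to division), and
   their difference has positive coefficients in M - 2 and n / 2 - 2. *)

(** * Bounding distances by potentials *)

Section Potential.
Variables (T : finType) (e : rel T) (h : T -> nat) (t : T).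

(** Each arc to a lower neighbour costs at least one unit of [h], so the walk must stop, and it can
    stop only at [t]. *)
Lemma descent_path :
  (forall u, u != t -> exists2 v, e u v & h v < h u) ->
  forall u, exists p, [/\ path e u p, last u p = t & size p <= h u].
Proof.
move=> descent u; have [k] := ubnP (h u); elim: k u => // k IHk u le_u_k.
have [->|/descent[v e_uv lt_vu]] := eqVneq u t; first by exists [::].
have [|p [path_p last_p size_p]] := IHk v; first exact: leq_trans lt_vu _.
by exists (v :: p); rewrite /= e_uv; split=> //; apply: leq_ltn_trans lt_vu.
Qed.

Lemma dist_le_potential u :
  (forall u, u != t -> exists2 v, e u v & h v < h u) -> dist e u t <= h u.
Proof.
move=> /descent_path/(_ u)[p [path_p <- size_p]].
exact: leq_trans (dist_le path_p) size_p.
Qed.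

Lemma connect_potential u :
  (forall u, u != t -> exists2 v, e u v & h v < h u) -> connect e u t.
Proof. by move=> /descent_path/(_ u)[p [? <- _]]; apply/connectP; exists p. Qed.

(** Along a shortest path [h] loses at most 1 per arc. Connectivity is assumed because [dist] is 0
    by default when there is no path. *)
Lemma potential_le_dist u :
  (forall u v, e u v -> h u <= (h v).+1) -> h t = 0 -> connect e u t ->
  h u <= dist e u t.
Proof.
move=> lip h0 /dist_path[p [path_p last_p _ <-]].
rewrite -[h u]subn0 -h0 -last_p {last_p} leq_subLR.
elim: p u path_p => [|v p IHp] u /=; first by rewrite addn0.
by case/andP=> /lip h_uv /IHp; lia.
Qed.

End Potential.

(** * Distances in the two orientations *)

Section Arcs.
Variables m n : nat.
Implicit Types u v : vertex m n.

(* [Defs.] is needed because path.v has lemmas [left_arc] and [right_arc]. *)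
Lemma D_arcE u v : D_arc u v =
  let: (i, j, k, l) := (u.1 : nat, u.2 : nat, v.1 : nat, v.2 : nat) in
  [|| [&& j.+1 < n, i == k.+1 & j == l], [&& j.+1 == n, k == i.+1 & j == l],
      [&& i == 0, k == 0 & l == j.+1] | [&& 0 < i, i == k & j == l.+1]].
Proof.
case: u v => [[i hi] [j hj]] [[k hk] [l hl]].
rewrite /D_arc /up_arc /Defs.left_arc /down_arc /Defs.right_arc /irow /icol /=; lia.
Qed.

(** The four cases are the arcs to the right, to the left, down and up. Numbering from 0 swaps the
    parities: leftward arcs leave odd columns in the last row and even columns in row 1. *)
Lemma C_arcE u v : 2 < m -> ~~ odd n -> C_arc u v =
  let: (i, j, k, l) := (u.1 : nat, u.2 : nat, v.1 : nat, v.2 : nat) in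
  [|| [&& i == k, l == j.+1 & ~~ [|| (i.+1 == m) && odd l | (i == 1) && ~~ odd l]],
      [&& i == k, j == l.+1 & (i.+1 == m) && odd j || (i == 1) && ~~ odd j],
      [&& j == l, k == i.+1 & (j.+1 == n) || (0 < i) && odd j]
    | [&& j == l, i == k.+1 & (k == 0) && (j.+1 < n) || (0 < k) && ~~ odd j]].
Proof.
case: u v => [[i hi] [j hj]] [[k hk] [l hl]] m_ge3 even_n.
rewrite /C_arc /comb_cycle_arc /up_arc /Defs.left_arc /down_arc /Defs.right_arc.
rewrite /irow /icol /= !eqSS.
have [?|?] := eqVneq i k; have [?|?] := eqVneq j l; subst=> /=;
  rewrite ?(ltn_eqF (ltnSn _), gtn_eqF (ltnSn _), andbF, andbT, orbF) /=; last by lia.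
- by lia.
- have [?|?] := eqVneq l j.+1; last have [?|?] := eqVneq j l.+1; subst; rewrite ?andbF //;
    [case: (boolP (odd j)) | case: (boolP (odd l))] => ?;
    have [?|?] := posnP k; have [?|?] := eqVneq k 1; have [?|?] := eqVneq k.+1 m; lia.
- have [?|?] := eqVneq i k.+1; last have [?|?] := eqVneq k i.+1; subst;
    case: (boolP (odd l)) => ?; have [?|?] := eqVneq l.+1 n;  have [?|?] := posnP l; lia.
Qed.

End Arcs.

Definition gap a b := (a - b) + (b - a).

Ltac case_ifs := repeat (case: ifP; move=> /= ?); lia.

(** * Explicit bounds on the distances *)

Section Bounds.
Variables M N : nat.

(** Each case is the length of a walk: directly where the arcs allow it, otherwise up to row 0,
    right to column N, down to row k and left to column l. An extra 2 pays for a side step into row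
    1 or column N - 1 and back. *)
Definition D_bound i j k l :=
  if i == 0 then
    if (k == 0) && (j <= l) then l - j
    else (N - j) + (N - l) + (if k == 0 then 2 else k)
  else if k == 0 then gap j l + i + (if (j == N) && (l == N) then 2 else 0)
  else if j == N then
    if (l < N) || (i <= k) then gap i k + (N - l) else i + k + 2
  else if (l <= j) && (k <= i) then (i - k) + (j - l)
  else i + k + (N - j) + (N - l).

(* In column j, the arc to the left starts in row [exit_row j]; the arc arriving
   in column l from the right ends in row [entry_row l]. *)
Definition exit_row j := if odd j then M else 1.
Definition entry_row l := if odd l then 1 else M.

Lemma exit_row_end j : exit_row j = 1 \/ exit_row j = M.
Proof. by rewrite /exit_row; case: ifP; [right | left]. Qed.

Lemma entry_row_end l : entry_row l = 1 \/ entry_row l = M.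
Proof. by rewrite /entry_row; case: ifP; [left | right]. Qed.

(* Whether a path from (i, j) to (k, l), j <= l, is at least 2 longer than the
   grid distance. This captures only some such pairs, but enough for the final
   inequality to hold for m = 3 and n = 4, where the slack is 4. *)
Definition detour i j k l :=
  if j == l then (0 < k) && (if odd j then k < i else i < k)
  else [&& i == 1, k == 1 & odd j || (j.+1 < l)] ||
       [&& i == M, k == M & ~~ odd j || (j.+1 < l)].

(** On the way left, an intermediate column is crossed from its entry row to its exit row in M - 1
    steps and left by one more, hence the factor M. Row 0 can be left only in column N. *)
Definition C_bound i j k l :=
  if i == 0 then
    if (k == 0) && (j <= l) then l - j
    else (N - j) + M * (N - l) + 1 + gap k (entry_row l)
  else if l < j then
    M * (j - l - 1) + 1 + gap i (exit_row j) + gap k (entry_row l)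
  else (l - j) + gap i k + (detour i j k l).*2.

Implicit Types u t : vertex M.+1 N.+1.

(** The descending arc goes right in row 0 and down at its last vertex. In a column before N it goes
    left if the target is to the left and not below, and up otherwise; in column N it goes down if
    the target is below, and left otherwise. *)
Lemma dist_D_le u t : 1 < M -> 1 < N ->
  dist (@D_arc M.+1 N.+1) u t <= D_bound u.1 u.2 t.1 t.2.
Proof.
move=> M_gt1 N_gt1.
apply: (@dist_le_potential _ _ (fun u => D_bound u.1 u.2 t.1 t.2)).
move: t => [[k hk] [l hl]] [[i hi] [j hj]] /= neq.
have {}neq : ~~ ((i == k) && (j == l)).
  by apply: contra neq => /andP[/eqP ik /eqP jl]; apply/eqP; congr pair; apply: val_inj.
suff [i' [j' [hi' hj' arc desc]]] : exists i' j', [/\ i' < M.+1, j' < N.+1,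
  [|| [&& j < N, i == i'.+1 & j == j'], [&& j == N, i' == i.+1 & j == j'],
      [&& i == 0, i' == 0 & j' == j.+1] | [&& 0 < i, i == i' & j == j'.+1]] &
  D_bound i' j' k l < D_bound i j k l].
  by exists (Ordinal hi', Ordinal hj'); rewrite ?D_arcE.
have [i0|i0] := posnP i.
  subst; have [jN|jN] := ltnP j N.
    exists 0, j.+1; split=> //.
      lia.
    rewrite /D_bound /gap /=; case: (eqVneq k 0) => /= ?.
      case_ifs.
    by lia.
  exists 1, j; split=> //; try lia.
  rewrite /D_bound /gap /=; case_ifs.
have [jN|jN] := ltnP j N.
  have [lt|lt] := boolP ((l < j) && (k <= i)).
    exists i, j.-1; split=> //; try lia.
    rewrite /D_bound /gap /=; case_ifs.
  exists i.-1, j; split=> //; try lia.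
  rewrite /D_bound /gap /=; case_ifs.
have [ik|ik] := ltnP i k.
  exists i.+1, j; split=> //; try lia.
  rewrite /D_bound /gap /=; case_ifs.
exists i, j.-1; split=> //; try lia.
rewrite /D_bound /gap /=; case_ifs.
Qed.

End Bounds.

(** * Strong connectivity of the comb orientation *)

Section CombConnectivity.
Variables M N : nat.
Implicit Types u t : vertex M.+1 N.+1.
Hypotheses (M_gt1 : 1 < M) (odd_N : odd N).

Let even_n : ~~ odd N.+1. Proof. by rewrite /= odd_N. Qed.
Let corner : vertex M.+1 N.+1 := (ord0, ord_max).

Lemma C_connect_to_corner u : connect (@C_arc M.+1 N.+1) u corner.
Proof.
(* Column N can only be descended, so below row 0 its vertices first go down to row M and then left
   to (M, N - 1), where [h] is M + 1. *)
pose h i j := if i == 0 then N - j else if j < N then i + (N - j) else M.*2 + 2 - i.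
apply: (@connect_potential _ _ (fun u => h u.1 u.2)) => {u} -[[i hi] [j hj]] neq.
have {}neq : ~~ ((i == 0) && (j == N)).
  by apply: contra neq => /andP[/eqP ? /eqP ?]; apply/eqP; congr pair; apply: val_inj.
suff [i' [j' [hi' hj' arc desc]]] : exists i' j', [/\ i' < M.+1, j' < N.+1,
  [|| [&& i == i', j' == j.+1 & ~~ [|| (i == M) && odd j' | (i == 1) && ~~ odd j']],
      [&& i == i', j == j'.+1 & (i == M) && odd j || (i == 1) && ~~ odd j],
      [&& j == j', i' == i.+1 & (j == N) || (0 < i) && odd j]
    | [&& j == j', i == i'.+1 & (i' == 0) && (j < N) || (0 < i') && ~~ odd j]] &
  h i' j' < h i j].
  by exists (Ordinal hi', Ordinal hj'); rewrite ?C_arcE.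
have [i0|i0] := posnP i.
  exists 0, j.+1; split; try lia; rewrite /h; case_ifs.
have [jN|jN] := ltnP j N; last first.
  have [iM|iM] := ltnP i M; [exists i.+1, j | exists i, j.-1]; split; try lia;
    rewrite /h; case_ifs.
have [ij|ij] := boolP ((i == 1) || ~~ odd j); [exists i.-1, j | exists i, j.+1];
  split; try lia; rewrite /h; case_ifs.
Qed.

Lemma C_connect_from_corner u : connect (@C_arc M.+1 N.+1) corner u.
Proof.
(* Essentially the position along the Hamiltonian cycle. *)
pose h i j := if i == 0 then if j == N then 0 else N.+1 * M.+1 + j
              else (N - j) * M.+1 + (if odd j then i else M - i).
(* In the reversed digraph the corner becomes the target, so the descent runs through
   predecessors. *)
have -> : connect (@C_arc M.+1 N.+1) corner u =
          connect (fun x y => @C_arc M.+1 N.+1 y x) u corner.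
  by rewrite connect_rev.
apply: (@connect_potential _ _ (fun u => h u.1 u.2)) => {u} -[[i hi] [j hj]] neq.
have {}neq : ~~ ((i == 0) && (j == N)).
  by apply: contra neq => /andP[/eqP ? /eqP ?]; apply/eqP; congr pair; apply: val_inj.
suff [i' [j' [hi' hj' arc desc]]] : exists i' j', [/\ i' < M.+1, j' < N.+1,
  [|| [&& i' == i, j == j'.+1 & ~~ [|| (i' == M) && odd j | (i' == 1) && ~~ odd j]],
      [&& i' == i, j' == j.+1 & (i' == M) && odd j' || (i' == 1) && ~~ odd j'],
      [&& j' == j, i == i'.+1 & (j' == N) || (0 < i') && odd j']
    | [&& j' == j, i' == i.+1 & (i == 0) && (j' < N) || (0 < i) && ~~ odd j']] &
  h i' j' < h i j].
  by exists (Ordinal hi', Ordinal hj'); rewrite ?C_arcE.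
have [i0|i0] := posnP i.
  have [j0|j0] := posnP j; [exists 1, 0 | exists 0, j.-1]; rewrite /h i0; split; try lia.
  rewrite /= j0 /= subn0 mulSn; case_ifs.
  rewrite /=; case_ifs.
have hS : (N - j) * M.+1 = if j < N then M.+1 + (N - j.+1) * M.+1 else 0.
  have [jN|jN] := ltnP j N; last by rewrite (_ : N - j = 0) //; lia.
  by rewrite -mulSn; congr (_ * _); lia.
have [oj|oj] := boolP (odd j).
  have [i1|i1] := eqVneq i 1; last first.
    by exists i.-1, j; rewrite /h; split; try lia; case_ifs.
  have [jN|jN] := eqVneq j N; [exists 0, j | exists i, j.+1]; rewrite /h; split; try lia.
    case_ifs.
  by rewrite hS; case_ifs.
have jN : j < N by case: (ltngtP j N) hj oj odd_N => // [|->]; lia.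
have [iM|iM] := eqVneq i M; [exists i, j.+1 | exists i.+1, j]; rewrite /h; split; try lia.
- rewrite hS; case_ifs.
- case_ifs.
Qed.

Lemma C_bound_diag u : C_bound M N u.1 u.2 u.1 u.2 = 0.
Proof.
rewrite /C_bound /detour /gap; case: u => [[i hi] [j hj]] /=.
rewrite ltnn leqnn eqxx; case_ifs.
Qed.

End CombConnectivity.

(** * The comb bound drops by at most 1 along each kind of arc *)

Section CombDistances.
Variables M N : nat.
Implicit Types u v t : vertex M.+1 N.+1.
Hypotheses (M_gt1 : 1 < M) (odd_N : odd N).

Lemma C_bound_row0 j k l :
  C_bound M N 0 j k l = if (k == 0) && (j <= l) then l - j
    else (N - j) + M * (N - l) + 1 + gap k (entry_row M l).
Proof. by []. Qed.

Lemma C_bound_left i j k l : 0 < i -> l < j -> C_bound M N i j k l =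
  M * (j - l - 1) + 1 + gap i (exit_row M j) + gap k (entry_row M l).
Proof. by rewrite /C_bound lt0n => /negbTE-> ->. Qed.

Lemma C_bound_right i j k l : 0 < i -> j <= l -> C_bound M N i j k l =
  (l - j) + gap i k + (detour M i j k l).*2.
Proof. by rewrite /C_bound lt0n => /negbTE-> jl; rewrite ltnNge jl. Qed.

(** Between different columns the extra 2 occurs only where [gap i k] is 0. A vertical arc there
    raises the gap to 1, so losing the detour lowers the bound by just 1. *)
Lemma detour_lt i j k l : j < l -> detour M i j k l -> i = k /\ 0 < k.
Proof. by rewrite /detour => jl; case: eqVneq => ?; lia. Qed.

Lemma C_bound_lip_right i j k l : i <= M -> j < N -> k <= M -> l <= N ->
  ~~ ((i == M) && ~~ odd j || (i == 1) && odd j) ->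
  C_bound M N i j k l <= (C_bound M N i j.+1 k l).+1.
Proof.
move=> iM jN kM lN arc; have [->|i0] := posnP i.
  by rewrite !C_bound_row0 /gap /entry_row; move: (M * _) => ?;
    case: (k == 0); case: (ltngtP j l) => ? /=; lia.
have [lj|jl|jl] := ltngtP l j.
- rewrite !C_bound_left //; last lia. move: (gap k _) => ?.
  rewrite (_ : j.+1 - l - 1 = (j - l - 1).+1) ?mulnSr; last lia.
  move: (M * _) => ?; rewrite /gap /exit_row; case: ifP; case: ifP; lia.
- rewrite !C_bound_right //; [ | lia..].
  (* The shorter column distance uses up the whole allowance of 1, so a detour must persist. It
     does: row 1 has rightward arcs only out of even columns and row M only out of odd ones, so the
     next column has the blocking parity. *)
  suff : detour M i j k l -> detour M i j.+1 k l.
    by case: detour; case: detour; rewrite /gap; lia.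
  rewrite /detour /=; move: arc; case: (odd j) => /=;
    case: (eqVneq j l) => ?; case: (eqVneq j.+1 l) => ?; lia.
- subst l; rewrite C_bound_right // C_bound_left // /detour eqxx /exit_row /entry_row /gap /=.
  rewrite subSnn subnn muln0; case: (odd j) => /=; lia.
Qed.

(** The arc starts in the exit row of column j + 1 and arrives at distance M - 1 from the exit row
    of column j. This makes up for the lost multiple of M, up to 1. *)
Lemma C_bound_lip_left i j k l : j < N -> k <= M -> l <= N ->
  (i == M) && ~~ odd j || (i == 1) && odd j ->
  C_bound M N i j.+1 k l <= (C_bound M N i j k l).+1.
Proof.
move=> jN kM lN arc; have i0 : 0 < i by lia.
have [lj|jl|jl] := ltngtP l j.
- rewrite !C_bound_left //; last lia. move: (gap k _) => ?.
  rewrite (_ : j.+1 - l - 1 = (j - l - 1).+1) ?mulnSr; last lia.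
  move: (M * _) => ?; rewrite /gap /exit_row /=; move: arc; case: (odd j) => /=; lia.
- rewrite !C_bound_right //; [ | lia..].
  rewrite /gap; case: detour; case: detour; lia.
- subst l; rewrite C_bound_left // C_bound_right // /exit_row /entry_row /gap /=.
  rewrite subSnn subnn muln0; move: arc; case: (odd j) => /=; lia.
Qed.

Lemma C_bound_lip_down i j k l : i < M -> j <= N -> k <= M -> l <= N ->
  (j == N) || (0 < i) && odd j ->
  C_bound M N i j k l <= (C_bound M N i.+1 j k l).+1.
Proof.
move=> iM jN kM lN arc; have [i0|i0] := posnP i.
  have jN' : j = N by lia.
  rewrite i0 jN' C_bound_row0 subnn.
  have [ltN|geN] := ltnP l N.
    (* Column N is left in row M: this arc and the M - 1 further steps down account for one factor
       M. *)
    have -> : M * (N - l) = M * (N - l - 1) + M.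
      by rewrite -mulnSr; congr (_ * _); lia.
    rewrite C_bound_left // andbF; move: (M * _) (gap k _) => ? ?.
    rewrite /exit_row odd_N /gap; lia.
  have -> : l = N by lia.
  rewrite C_bound_right // subnn muln0 /entry_row odd_N /gap; case: (eqVneq k 0) => ? /=; lia.
have oj : odd j by case: (eqVneq j N) arc => [->|] //=; rewrite i0.
have [lj|jl|jl] := ltngtP l j.
- rewrite !C_bound_left //. move: (gap k _) (M * _) => ? ?.
  rewrite /gap /exit_row; case: ifP; lia.
- rewrite !C_bound_right // ?(ltnW jl) //.
  have := @detour_lt i _ k _ jl.
  by case: detour => [/(_ isT)|_]; case: detour; rewrite /gap; lia.
- subst l; rewrite !C_bound_right // /detour eqxx oj /gap; lia.
Qed.

Lemma C_bound_lip_up i j k l : i < M -> j <= N -> k <= M -> l <= N ->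
  (i == 0) && (j < N) || (0 < i) && ~~ odd j ->
  C_bound M N i.+1 j k l <= (C_bound M N i j k l).+1.
Proof.
move=> iM jN kM lN arc; have [i0|i0] := posnP i.
  have jN' : j < N by lia.
  rewrite i0 C_bound_row0.
  have [lj|jl] := ltnP l j.
    rewrite C_bound_left // andbF.
    have : M * (j - l - 1) + M <= M * (N - l).
      by rewrite -mulnSr leq_mul2l; lia.
    move: (M * _) (M * _) (gap k _) => ? ? ?. rewrite /exit_row /gap; case: ifP; lia.
  rewrite C_bound_right // andbT; case: eqVneq => [->|k0].
    rewrite /detour /gap; case: eqVneq => ?; lia.
  rewrite /entry_row /=; case: ifP => ol.
    by move: (M * _) => ?; case: detour; rewrite /gap; lia.
  (* Since l is even and N is odd, column l is not the last one, so the bound from row 0 contains at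
     least one M, enough to offset the different row terms. *)
  have lN' : l < N by rewrite ltn_neqAle lN andbT; apply: contraFneq ol => ->.
  have : M <= M * (N - l) by rewrite leq_pmulr // subn_gt0.
  by move: (M * _) => ?; case: detour; rewrite /gap; lia.
have oj : ~~ odd j by case: (odd j) arc; rewrite // andbF; lia.
have [lj|jl|jl] := ltngtP l j.
- rewrite !C_bound_left //. move: (gap k _) (M * _) => ? ?.
  rewrite /gap /exit_row; case: ifP; lia.
- rewrite !C_bound_right // ?(ltnW jl) //.
  have := @detour_lt i.+1 _ k _ jl.
  by case: detour => [/(_ isT)|_]; case: detour; rewrite /gap; lia.
- subst l; rewrite !C_bound_right // /detour eqxx (negbTE oj) /gap; lia.
Qed.

Lemma C_bound_lipschitz u v t : C_arc u v ->
  C_bound M N u.1 u.2 t.1 t.2 <= (C_bound M N v.1 v.2 t.1 t.2).+1.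
Proof.
rewrite C_arcE //=; last by rewrite odd_N.
case: u v t => [[i hi] [j hj]] [[i' hi'] [j' hj']] [[k hk] [l hl]] /=.
rewrite !eqSS => /or4P[] /and3P[/eqP ? /eqP ?]; subst=> /=; rewrite ?negbK => arc.
- exact: C_bound_lip_right.
- by apply: C_bound_lip_left; rewrite //= negbK in arc *.
- exact: C_bound_lip_down.
- exact: C_bound_lip_up.
Qed.

Lemma C_bound_le_dist u t : C_bound M N u.1 u.2 t.1 t.2 <= dist (@C_arc M.+1 N.+1) u t.
Proof.
apply: (@potential_le_dist _ _ (fun u => C_bound M N u.1 u.2 t.1 t.2)).
- by move=> ? ?; apply: C_bound_lipschitz.
- exact: C_bound_diag.
- apply: connect_trans (C_connect_to_corner M_gt1 odd_N u) _.
  exact: C_connect_from_corner.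
Qed.

End CombDistances.

(** * Summing the bounds *)

Definition square_sum M (F : nat -> nat -> nat) := \sum_(i < M) \sum_(k < M) F i k.

Lemma sum_vertex_pairs m n (F : nat -> nat -> nat -> nat -> nat) :
  \sum_(p : vertex m n * vertex m n) F p.1.1 p.1.2 p.2.1 p.2.2 =
  square_sum n (fun j l => square_sum m (fun i k => F i j k l)).
Proof.
rewrite -(pair_big xpredT xpredT (fun u v : vertex m n => F u.1 u.2 v.1 v.2)) /=.
rewrite -(pair_big xpredT xpredT (fun (i : 'I_m) (j : 'I_n) =>
  \sum_(v : vertex m n) F i j v.1 v.2)) /= exchange_big; apply: eq_bigr => j _.
under eq_bigr => i _ do rewrite -(pair_big xpredT xpredT
  (fun (k : 'I_m) (l : 'I_n) => F i j k l)) /= exchange_big.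
by rewrite exchange_big.
Qed.

Lemma sum_triangle n F :
  square_sum n F = \sum_(j < n) F j j + \sum_(j < n) \sum_(l < j) (F j l + F l j).
Proof.
rewrite /square_sum; elim: n => [|n IHn]; first by rewrite !big_ord0.
rewrite (eq_bigr (fun j : 'I_n.+1 => \sum_(l < n) F j l + F j n)); last first.
  by move=> j _; rewrite big_ord_recr.
rewrite big_split /=.
rewrite !big_ord_recr /= IHn !big_split /=; lia.
Qed.

(** Row 0 is split off because both bounds follow separate formulas there. *)
Lemma square_sum_split M F : square_sum M.+1 F =
  F 0 0 + \sum_(k < M) F 0 k.+1 + \sum_(i < M) F i.+1 0 +
  square_sum M (fun i k => F i.+1 k.+1).
Proof.
rewrite /square_sum big_ord_recl big_ord_recl /=.
by under [X in _ + X = _]eq_bigr do rewrite big_ord_recl; rewrite big_split /= !addnA.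
Qed.

(** * Power sums and sums over pairs of rows *)

Definition lin n := \sum_(j < n) j.
Definition sq n := \sum_(j < n) j ^ 2.

Lemma lin_closed n : 2 * lin n + n = n ^ 2.
Proof. by elim: n => [|n IHn]; rewrite /lin ?big_ord0 // big_ord_recr /= -/(lin n); nia. Qed.

Lemma sq_closed n : 6 * sq n + 3 * n ^ 2 = 2 * n ^ 3 + n.
Proof. by elim: n => [|n IHn]; rewrite /sq ?big_ord0 // big_ord_recr /= -/(sq n); nia. Qed.

Lemma sum_const n c : \sum_(j < n) c = n * c.
Proof. by rewrite big_const_ord iter_addn_0 mulnC. Qed.

Lemma lin_rev n : \sum_(l < n) (n - l.+1) = lin n.
Proof.
rewrite (reindex_inj rev_ord_inj) /=; apply: eq_bigr => i _.
by rewrite subnSK // subKn // ltnW.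
Qed.

Lemma sum_gap M : square_sum M gap = sq M + lin M.
Proof.
rewrite sum_triangle big1 => [|i _]; last by rewrite /gap subnn.
rewrite add0n /sq /lin -big_split /=; apply: eq_bigr => i _.
transitivity (\sum_(k < i) (2 * (i - k.+1) + 2)).
  by apply: eq_bigr => k _; have := ltn_ord k; rewrite /gap; lia.
rewrite big_split /= -big_distrr /= lin_rev sum_const.
by have := lin_closed i; lia.
Qed.

(** Both ends of the range of rows give the same sum, so the parity in [exit_row] and [entry_row]
    drops out. *)
Lemma sum_gap_end M x : x = 1 \/ x = M -> \sum_(i < M) gap i.+1 x = lin M.
Proof.
case=> ->; last rewrite -lin_rev; apply: eq_bigr => i _; have := ltn_ord i; rewrite /gap; lia.
Qed.

Lemma sum_succ M c : \sum_(i < M) (c + i.+1) = M * c + M + lin M.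
Proof.
rewrite big_split /= sum_const -addnA; congr (_ + _).
by under eq_bigr do rewrite -addn1; rewrite big_split /= sum_const muln1 addnC.
Qed.

Lemma sum_separate M c (a b : nat -> nat) :
  square_sum M (fun i k => c + a i + b k) =
  M ^ 2 * c + M * \sum_(i < M) a i + M * \sum_(k < M) b k.
Proof.
rewrite /square_sum; under eq_bigr do rewrite big_split /= sum_const.
rewrite big_split /= sum_const -big_distrr /= big_split /= sum_const; lia.
Qed.

(** This is the shape of [D_bound] on the rows below row 0 when l <= j < N. For k < i the entries at
    (i, k) and (k, i) add up to 2i + c + d. *)
Lemma sum_wedge M c d :
  square_sum M (fun i k => if k <= i then i - k + c else i + k + d) =
  M * c + lin M * (c + d) + 2 * sq M.
Proof.
rewrite sum_triangle; under eq_bigr do rewrite leqnn subnn.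
rewrite sum_const -addnA; congr (_ + _).
rewrite /lin /sq big_distrl big_distrr /= -big_split /=; apply: eq_bigr => i _.
transitivity (\sum_(k < i) (2 * i + c + d)); last by rewrite sum_const; lia.
by apply: eq_bigr => k _; have ki := ltn_ord k; rewrite ltnW // leqNgt ki /=; lia.
Qed.

Lemma eq_square_sum M F G :
  (forall i k, i < M -> k < M -> F i k = G i k) -> square_sum M F = square_sum M G.
Proof. by move=> eqFG; apply: eq_bigr => i _; apply: eq_bigr => k _; apply: eqFG. Qed.

Lemma square_sum_swap M F : square_sum M F = square_sum M (fun i k => F k i).
Proof. exact: exchange_big. Qed.

Lemma square_sumD M F G :
  square_sum M (fun i k => F i k + G i k) = square_sum M F + square_sum M G.
Proof. by rewrite /square_sum -big_split; apply: eq_bigr => i _; rewrite big_split. Qed.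

Lemma square_sumMr M F c : square_sum M (fun i k => F i k * c) = square_sum M F * c.
Proof. by rewrite /square_sum big_distrl; apply: eq_bigr => i _; rewrite big_distrl. Qed.

Lemma square_sum_const M c : square_sum M (fun _ _ => c) = M ^ 2 * c.
Proof. by rewrite /square_sum !sum_const mulnA. Qed.

Lemma square_sum_diag M c (b : bool) : c < M ->
  square_sum M (fun i k => [&& i == c, k == c & b]) = b.
Proof.
move=> ltcM; rewrite /square_sum (bigD1 (Ordinal ltcM)) //= (bigD1 (Ordinal ltcM)) //= eqxx.
rewrite !big1 ?addn0 // => i ne_ic; last by rewrite (_ : _ == _ = false) //; apply/negbTE.
by rewrite big1 // => k _; rewrite (_ : nat_of_ord i == c = false) //; apply/negbTE.
Qed.

Lemma square_sum_strict M (F : nat -> nat -> bool) :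
  (forall i, F i i = false) -> (forall i k, k < i -> F i k + F k i = 1) ->
  square_sum M F = lin M.
Proof.
move=> Fii Fik; rewrite sum_triangle big1 => [|i _]; last by rewrite Fii.
apply: eq_bigr => i _; transitivity (\sum_(k < i) 1); last by rewrite sum_const muln1.
by apply: eq_bigr => k _; apply: Fik.
Qed.

(** * Sums over all rows for two fixed columns *)

Section Columns.
Variables M N : nat.
Hypotheses (M_gt1 : 1 < M) (odd_N : odd N).
Let P := lin M.
Let S := sq M.

Definition D_columns j l := square_sum M.+1 (fun i k => D_bound N i j k l).
Definition C_columns j l := square_sum M.+1 (fun i k => C_bound M N i j k l).

Lemma D_columns_split j l : j <= N -> l <= N -> D_columns j l =
  (if j <= l then l - j else N - j + (N - l) + 2) +
  (M * (N - j + (N - l)) + M + P) +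
  (M * (gap j l + (if (j == N) && (l == N) then 2 else 0)) + M + P) +
  square_sum M (fun i k => D_bound N i.+1 j k.+1 l).
Proof.
move=> jN lN; rewrite /D_columns square_sum_split /D_bound /= -!sum_succ.
congr (_ + _ + _ + _); apply: eq_bigr => i _; lia.
Qed.

Lemma C_columns_split j l : j <= N -> l <= N -> C_columns j l =
  (if j <= l then l - j else N - j + M * (N - l) + 1 + entry_row M l) +
  (M * (N - j + M * (N - l) + 1) + P) +
  (if l < j then M * (M * (j - l - 1) + 1) + P + M * entry_row M l
   else M * (l - j) + M + P) +
  square_sum M (fun i k => C_bound M N i.+1 j k.+1 l).
Proof.
have entry_end := entry_row_end M.
have exit_end := exit_row_end M.
move=> jN lN; rewrite /C_columns square_sum_split /C_bound /=.
congr (_ + _ + _ + _).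
- by rewrite /gap sub0n subn0 add0n.
- by rewrite big_split /= sum_const sum_gap_end.
- have [lj|jl] := ltnP l j.
    rewrite big_split /= sum_const big_split /= sum_const sum_gap_end // /gap -/P; lia.
  rewrite -sum_succ; apply: eq_bigr => i _; rewrite /detour /gap; case: eqVneq => ?; lia.
Qed.

Lemma D_columns_diag j : j <= N ->
  D_columns j j = 2 * M + 4 * P + 2 * S + (2 * M + 2 * P) * (N - j) +
                  (j == N) * (2 * M + 2 * P).
Proof.
move=> jN; rewrite D_columns_split // leqnn subnn /gap subnn /D_bound /= andbb.
have [->|neqN] := eqVneq j N.
  (* Column N is directed downward, so the wedge is transposed; 4 is the 2 of [D_bound] plus the two
     row shifts. *)
  rewrite square_sum_swap (_ : square_sum _ _ =
    square_sum M (fun i k => if k <= i then i - k + 0 else i + k + 4)); last first.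
    by apply: eq_square_sum => i k _ _; rewrite ltnn /= ltnS; case: ifP; rewrite /gap; lia.
  rewrite sum_wedge -/P -/S subnn; lia.
rewrite (_ : square_sum _ _ = square_sum M (fun i k =>
    if k <= i then i - k + 0 else i + k + (2 + 2 * (N - j)))).
  rewrite sum_wedge -/P -/S; lia.
apply: eq_square_sum => i k _ _; rewrite leqnn /= ltnS; case: ifP; lia.
Qed.

(** From column N a lower row is reached directly, so the wedge is replaced by [gap]. The saving
    [S + P] stands on the left to avoid subtraction. *)
Lemma D_columns_pair j l (d := j - l) (a := N - j) : l < j -> j <= N ->
  D_columns j l + D_columns l j + (j == N) * (S + P) =
  (2 * a + 2 * d + 2) + 2 * (M * (2 * a + d + 1) + P) + 2 * (M * (d + 1) + P) +
  (M * d + P * (2 * a + 2 * d + 2) + 2 * S) +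
  (M ^ 2 * (2 + 2 * a + d) + 2 * M * P).
Proof.
move=> lj jN; have lN : l < N by lia.
rewrite !D_columns_split ?(ltnW lN) // leqNgt lj /= ltnW //.
have -> : square_sum M (fun i k => D_bound N i.+1 l k.+1 j) = M ^ 2 * (2 + 2 * a + d) + 2 * M * P.
  rewrite (@eq_square_sum _ _ (fun i k => (2 + 2 * a + d) + i + k)).
    rewrite sum_separate -/(lin M) -/P; lia.
  by move=> i k _ _; rewrite /D_bound /= ltn_eqF // leqNgt lj /=; rewrite /a /d; lia.
have : square_sum M (fun i k => D_bound N i.+1 j k.+1 l) + (j == N) * (S + P) =
    M * d + P * (2 * a + 2 * d + 2) + 2 * S.
  have [jN'|neqN] := eqVneq j N.
    rewrite (@eq_square_sum _ _ (fun i k => gap i k + d)).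
      rewrite square_sumD square_sum_const sum_gap -/P -/S.
      have := lin_closed M; rewrite -/P /a jN' subnn => h. nia.
    by move=> i k _ _; rewrite /D_bound /= jN' eqxx lN /gap /d jN' /=; lia.
  rewrite (@eq_square_sum _ _ (fun i k => if k <= i then i - k + d else i + k + (2 * a + d + 2))).
    rewrite sum_wedge -/P -/S; lia.
  move=> i k _ _; rewrite /D_bound /= (negbTE neqN) ltnW // ltnS /= /a /d; case: ifP; lia.
have [ejl elN] : l - j = 0 /\ N - l = a + d by rewrite /a /d; lia.
rewrite (ltn_eqF lN) andbF /gap ejl elN /= -/a -/d.
move: a d (square_sum _ _) {ejl elN} => a' d' r.
move=> eD; rewrite /= !addn0; move: eD; move: ((j == N) * _) => c; lia.
Qed.

(** Within a column exactly one of the two vertical directions is a detour, which gives [lin M]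
    detours for either parity. *)
Lemma C_columns_diag j : j <= N ->
  C_columns j j = 2 * M + 5 * P + S + (M + M ^ 2) * (N - j).
Proof.
move=> jN; rewrite C_columns_split // leqnn ltnn subnn.
rewrite (@eq_square_sum _ _ (fun i k => gap i k + (if odd j then k < i else i < k) * 2)).
  rewrite square_sumD sum_gap square_sumMr square_sum_strict -/P -/S; first by lia.
    by case: odd => i; rewrite ltnn.
  by case: odd => i k ki; lia.
move=> i k _ _; rewrite /C_bound /= ltnn subnn /detour eqxx /= /gap; case: odd; lia.
Qed.

(** Rightward detours in rows 1 and M contribute 2 each. For adjacent columns only one of them is
    present, whence the correction on the left. *)
Lemma C_columns_pair j l (d := j - l) (a := N - j) (y := entry_row M l) : l < j -> j <= N ->
  C_columns j l + C_columns l j + 2 * (j == l.+1) =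
  (d + a + M * (a + d) + 1 + y) +
  (M * (a + M * (a + d) + 1) + P + M * (a + d + M * a + 1) + P) +
  (M * (d + 1) + P + M * (M * (d - 1) + 1) + P + M * y) +
  (M ^ 2 * (M * (d - 1) + 1) + 2 * M * P + M ^ 2 * d + S + P + 4).
Proof.
move=> lj jN; have lN : l < N by lia.
have entry_end := entry_row_end M.
have exit_end := exit_row_end M.
rewrite !C_columns_split ?(ltnW lN) // leqNgt lj /= ltnW // ltnNge (ltnW lj) /=.
have -> : square_sum M (fun i k => C_bound M N i.+1 j k.+1 l) =
    M ^ 2 * (M * (d - 1) + 1) + 2 * M * P.
  rewrite (@eq_square_sum _ _ (fun i k =>
      M * (d - 1) + 1 + gap i.+1 (exit_row M j) + gap k.+1 (entry_row M l))).
    rewrite (@sum_separate _ _ (fun i => gap i.+1 (exit_row M j))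
      (fun k => gap k.+1 (entry_row M l))).
    by rewrite !sum_gap_end // -/P; lia.
  by move=> i k _ _; rewrite C_bound_left.
have -> : square_sum M (fun i k => C_bound M N i.+1 l k.+1 j) =
    M ^ 2 * d + S + P + 4 - 2 * (j == l.+1).
  rewrite (@eq_square_sum _ _ (fun i k => (d + gap i k) +
      ([&& i == 0, k == 0 & odd l || (l.+1 < j)] +
       [&& i == M.-1, k == M.-1 & ~~ odd l || (l.+1 < j)]) * 2)).
    rewrite square_sumD square_sumD square_sum_const sum_gap square_sumMr square_sumD !square_sum_diag; [|lia..].
    rewrite -/P -/S; case: (odd l); case: eqVneq => ?; lia.
  move=> i k iM kM; rewrite C_bound_right ?(ltnW lj) // /detour ltn_eqF // /gap -/d !eqSS.
  have -> x : (x.+1 == M) = (x == M.-1) by lia.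
  move: (odd l || _) (~~ odd l || _) => b1 b2.
  by case: (eqVneq i 0) => ?; case: (eqVneq k 0) => ?;
    case: (eqVneq i M.-1) => ?; case: (eqVneq k M.-1) => ? /=; lia.
rewrite (_ : N - l = a + d) -?/y; last by rewrite /a /d; lia.
rewrite -/a -/d; case: eqVneq => ?; lia.
Qed.

End Columns.

(** * Sums over pairs of columns *)

Definition tri n (F : nat -> nat -> nat) := \sum_(j < n) \sum_(l < j) F j l.

Lemma eq_tri n F G :
  (forall j l, l < j -> j < n -> F j l = G j l) -> tri n F = tri n G.
Proof. by move=> eqFG; apply: eq_bigr => j _; apply: eq_bigr => l _; apply: eqFG. Qed.

Lemma triD n F G : tri n (fun j l => F j l + G j l) = tri n F + tri n G.
Proof. by rewrite /tri -big_split; apply: eq_bigr => j _; rewrite big_split. Qed.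

Lemma triMl n F c : tri n (fun j l => c * F j l) = c * tri n F.
Proof. by rewrite /tri big_distrr; apply: eq_bigr => j _; rewrite big_distrr. Qed.

Lemma tri_col n F : tri n (fun j _ => F j) = \sum_(j < n) j * F j.
Proof. by apply: eq_bigr => j _; rewrite sum_const. Qed.

Lemma tri_const n c : tri n (fun _ _ => c) = c * lin n.
Proof. by rewrite tri_col -big_distrl mulnC. Qed.

Lemma tri_gap n : 2 * tri n (fun j l => j - l - 1) + lin n = sq n.
Proof.
rewrite big_distrr -big_split; apply: eq_bigr => j _ /=.
under eq_bigr do rewrite -subnDA addn1.
by rewrite lin_rev -lin_closed.
Qed.

Lemma tri_co N : tri N.+1 (fun j _ => N - j) + sq N.+1 = N * lin N.+1.
Proof.
rewrite tri_col big_distrr -big_split; apply: eq_bigr => j _ /=.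
by have jN : j <= N := ltn_ord j; rewrite -mulnDr subnK // mulnC.
Qed.

Lemma tri_last N : tri N.+1 (fun j _ => j == N) = N.
Proof.
rewrite tri_col big_ord_recr /= eqxx muln1 big1 // => j _.
by rewrite ltn_eqF ?muln0.
Qed.

Lemma tri_next N : tri N.+1 (fun j l => j == l.+1) = N.
Proof.
rewrite /tri big_ord_recl big_ord0 add0n -[RHS]muln1 -sum_const; apply: eq_bigr => j _ /=.
by rewrite big_ord_recr eqxx big1 //= => l _; rewrite eqSS gtn_eqF ?ltn_ord.
Qed.

Lemma tri_entry M h :
  tri h.*2 (fun _ l => entry_row M l) + h = M * h ^ 2 + h ^ 2.
Proof.
(* Entry rows alternate between M and 1, so two consecutive columns contribute M + 1. *)
have row_entry k : \sum_(l < k.*2) entry_row M l = k * (M + 1).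
  elim: k => [|k IHk]; first by rewrite big_ord0.
  rewrite doubleS !big_ord_recr /= IHk /entry_row /= odd_double /=; lia.
elim: h => [|h IHh]; first by rewrite /tri big_ord0; lia.
rewrite /tri doubleS !big_ord_recr /= -/(tri _ (fun _ l => entry_row M l)) !row_entry.
rewrite [entry_row M h.*2]/entry_row odd_double; nia.
Qed.

Lemma sum_affine_co N c0 c1 c2 :
  \sum_(j < N.+1) (c0 + c1 * (N - j) + (j == N :> nat) * c2) =
  N.+1 * c0 + c1 * lin N.+1 + c2.
Proof.
rewrite big_split big_split sum_const -big_distrr /= -lin_rev; congr (_ + _ + _).
by rewrite big_ord_recr /= eqxx mul1n big1 // => j _; rewrite ltn_eqF.
Qed.

(** * Totals and their comparison *)

Section Totals.
Variables M h : nat.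
Hypotheses (M_gt1 : 1 < M).
Let n := h.*2.+2.
Let N := h.*2.+1.
Let P := lin M.
Let S := sq M.

Let odd_N : odd N. Proof. by rewrite /N /= odd_double. Qed.

(** Each pair of columns contributes an affine function of j - l - 1 and N - j. The term
    [N * (S + P)] collects the corrections from the N pairs containing column N. *)
Lemma D_total :
  square_sum n (D_columns M N) + N * (S + P) =
  n * (2 * M + 4 * P + 2 * S) + (2 * M + 2 * P) * lin n + (2 * M + 2 * P) +
  (4 + 9 * M + 8 * P + 2 * S + 3 * M ^ 2 + 2 * M * P) * lin n +
  (2 + 5 * M + 2 * P + M ^ 2) * tri n (fun j l => j - l - 1) +
  (2 + 4 * M + 2 * P + 2 * M ^ 2) * tri n (fun j _ => N - j).
Proof.
rewrite sum_triangle -/(tri n (fun j l => D_columns M N j l + D_columns M N l j)).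
rewrite (eq_bigr (fun j : 'I_n => 2 * M + 4 * P + 2 * S + (2 * M + 2 * P) * (N - j) +
                  (j == N :> nat) * (2 * M + 2 * P))); last first.
  by move=> j _; rewrite D_columns_diag // -ltnS.
rewrite sum_affine_co -/n -[LHS]addnA -[RHS]addnA -[in RHS]addnA; congr (_ + _).
rewrite -[X in X * (S + P)](tri_last N) mulnC -triMl -triD.
rewrite (@eq_tri _ _ (fun j l => (4 + 9 * M + 8 * P + 2 * S + 3 * M ^ 2 + 2 * M * P) +
  (2 + 5 * M + 2 * P + M ^ 2) * (j - l - 1) + (2 + 4 * M + 2 * P + 2 * M ^ 2) * (N - j))).
  by rewrite triD triD tri_const !triMl addnA.
move=> j l lj jN; rewrite [(S + P) * _]mulnC D_columns_pair //.
have -> : j - l = (j - l - 1) + 1 by lia.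
rewrite addnK -/P -/S; lia.
Qed.

(** The term [2 * N] collects the corrections from the N pairs of adjacent columns. *)
Lemma C_total :
  square_sum n (C_columns M N) + 2 * N =
  n * (2 * M + 5 * P + S) + (M + M ^ 2) * lin n +
  (6 + 7 * M + 5 * P + 3 * M ^ 2 + 2 * M * P + S) * lin n +
  (1 + 3 * M + 3 * M ^ 2 + M ^ 3) * tri n (fun j l => j - l - 1) +
  (1 + 3 * M + 2 * M ^ 2) * tri n (fun j _ => N - j) +
  (M + 1) * tri n (fun _ l => entry_row M l).
Proof.
rewrite sum_triangle -/(tri n (fun j l => C_columns M N j l + C_columns M N l j)).
rewrite (eq_bigr (fun j : 'I_n => 2 * M + 5 * P + S + (M + M ^ 2) * (N - j) +
                  (j == N :> nat) * 0)); last first.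
  by move=> j _; rewrite C_columns_diag ?muln0 ?addn0 // -ltnS.
rewrite sum_affine_co -/n addn0 -[LHS]addnA -[RHS]addnA -[in RHS]addnA.
rewrite -[in RHS]addnA; congr (_ + _).
rewrite -[X in 2 * X](tri_next N) -triMl -triD.
rewrite (@eq_tri _ _ (fun j l => (6 + 7 * M + 5 * P + 3 * M ^ 2 + 2 * M * P + S) +
  (1 + 3 * M + 3 * M ^ 2 + M ^ 3) * (j - l - 1) + (1 + 3 * M + 2 * M ^ 2) * (N - j) +
  (M + 1) * entry_row M l)).
  by rewrite triD triD triD tri_const !triMl; lia.
move=> j l lj jN; rewrite C_columns_pair //.
have -> : j - l = (j - l - 1) + 1 by lia.
rewrite addnK -/P -/S; lia.
Qed.

End Totals.

Lemma total_lt M h : 1 < M -> 0 < h ->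
  square_sum h.*2.+2 (D_columns M h.*2.+1) < square_sum h.*2.+2 (C_columns M h.*2.+1).
Proof.
move=> M_gt1 h_gt0; have := D_total h M_gt1; have := C_total h M_gt1.
move: (square_sum _ _) (square_sum _ _) => SD SC.
have := tri_entry M h.+1; have := tri_gap h.*2.+2; have := tri_co h.*2.+1.
have := lin_closed h.*2.+2; have := sq_closed h.*2.+2.
have := lin_closed M; have := sq_closed M; rewrite doubleS.
move: (tri _ _) (tri _ _) (tri _ _) (sq _) (lin _) (sq M) (lin M) => Y E A Q L S P.
(* Now x is M - 2 and y is n / 2 - 2. *)
case: M M_gt1 => [|[|x]] // _; case: h h_gt0 => [//|y] _.
rewrite -!muln2 !(expnS, expn0, muln1) => eqS eqP eqQ eqL eqA eqE eqY eqC eqD.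
have {}eqL : L = (y + 2) * (2 * y + 3) by clear -eqL; lia.
subst L.
have {}eqQ : 3 * Q = (y + 2) * (2 * y + 3) * (4 * y + 7) by clear -eqQ; lia.
have {}eqE : 3 * E = (2 * y + 3) * (y + 1) * (2 * y + 4) by clear -eqE eqQ; lia.
(* The triangular sums of j - l - 1 and of N - j are both the binomial coefficient of n over 3. *)
have {}eqA : A = E by clear -eqA eqE eqQ; lia.
subst A.
have {}eqP : 2 * P = (x + 2) * (x + 1) by clear -eqP; lia.
have {}eqS : 6 * S = (x + 1) * (x + 2) * (2 * x + 3) by clear -eqS; lia.
have {}eqY : Y = (x + 2) * (y + 2) ^ 2 + (y + 2) * (y + 1) by clear -eqY; lia.
subst Y.
clear eqQ.
(* P, S and E are only known up to the factors 2, 6 and 3, so [lia] is given the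
   multiples of these equations by the monomials that occur below. *)
have eP := (congr1 (muln y) eqP, congr1 (muln (y ^ 2)) eqP, congr1 (muln x) eqP,
  congr1 (muln (x * y)) eqP, congr1 (muln (x * y ^ 2)) eqP, congr1 (muln E) eqP).
have eS := (congr1 (muln y) eqS, congr1 (muln (y ^ 2)) eqS).
have eE := (congr1 (muln x) eqE, congr1 (muln (x ^ 2)) eqE, congr1 (muln (x ^ 3)) eqE).
(* The factor 6 clears the denominators of [P], [S] and [E]; the constant 24 keeps the inequality
   strict at x = y = 0. *)
have : 6 * SC = 6 * SD + 24 + (154 * y + 126 * y ^ 2 + 32 * y ^ 3 +
  104 * x + 382 * (x * y) + 328 * (x * y ^ 2) + 88 * (x * y ^ 3) +
  66 * x ^ 2 + 222 * (x ^ 2 * y) + 186 * (x ^ 2 * y ^ 2) + 48 * (x ^ 2 * y ^ 3) +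
  10 * x ^ 3 + 38 * (x ^ 3 * y) + 32 * (x ^ 3 * y ^ 2) + 8 * (x ^ 3 * y ^ 3)).
  case: eP => [[[[[]]]]]; case: eS; case: eE => [[]]; intros; lia.
move: (_ + 8 * _) => R; lia.
Qed.

Theorem theorem3 (m n : nat) (hm : 3 <= m) (hn : 4 <= n) (en : ~~ odd n) :
  wiener (@C_arc m n) > wiener (@D_arc m n).
Proof.
case: m hm => // M M_gt1.
have [h h_gt0 ->] : exists2 h, 0 < h & n = h.*2.+2.
  by exists n./2.-1; lia.
set N := h.*2.+1; have odd_N : odd N by rewrite /N /= odd_double.
apply: leq_ltn_trans (leq_trans (total_lt M_gt1 h_gt0) _).
  rewrite -(sum_vertex_pairs _ _ (D_bound N)); apply: leq_sum => -[u v] _.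
  by apply: dist_D_le => //; rewrite /N; lia.
rewrite -(sum_vertex_pairs _ _ (C_bound M N)); apply: leq_sum => -[u v] _.
exact: C_bound_le_dist.
Qed.
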